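(* Suppose $K<m$. Let $(\mathbf x^*,s^*,\hat{\boldsymbol\lambda}^*,\mathbf q',\mathbf Q')$ be an optimal solution of the problem (SDP) defined in the context, with optimal value $\Theta_{\mathrm M}(m)$, for which there are $\mathbf V\in\mathbb R^{m\times K}$ with orthonormal columns, $\mathbf Y_{11}\in\mathbb R^{K\times K}$ with $\mathbf Y_{11}\succeq 0$, $\boldsymbol\delta\in\mathbb R^K$ and $\boldsymbol\nu_k\in\mathbb R^K$ ($k\in[K]$) such that $\operatorname{rank}(\mathbf Q')\le K$, $\mathbf q'=\mathbf V\boldsymbol\delta$, $\mathbf Q'=\mathbf V\mathbf Y_{11}\mathbf V^\top$ and $(\mathbf U\boldsymbol\Lambda^{1/2})^\top(\mathbf A^\top\boldsymbol\lambda_k^*-y_k(\mathbf x^* ))=\mathbf V\boldsymbol\nu_k$ for all $k\in[K]$. Let $K\le m_1\le m$. Then there exists $\mathbf B^\dagger=[\mathbf V,\mathbf C]\in\mathcal B_{m_1}$, with $\mathbf C\in\mathbb R^{m\times(m_1-K)}$ and $[\mathbf V,\mathbf C]^\top[\mathbf V,\mathbf C]=\mathbf I_{m_1}$, such that, for this $\mathbf B^\dagger$, $$\mathbf x^\dagger=\mathbf x^*,\quad s^\dagger=s^*,\quad \hat{\boldsymbol\lambda}^\dagger=\hat{\boldsymbol\lambda}^*,\quad \mathbf q_{\mathrm r}^\dagger=(\boldsymbol\delta^\top,\mathbf 0_{m_1-K}^\top)^\top,\quad \mathbf Q_{\mathrm r}^\dagger=\begin{bmatrix}\mathbf Y_{11}&\mathbf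 0_{K\times(m_1-K)}\\ \mathbf 0_{(m_1-K)\times K}&\mathbf 0_{(m_1-K)\times(m_1-K)}\end{bmatrix}$$ is a feasible solution of the problem (R$_{\mathbf B^\dagger}$) defined in the context, and its objective value in (R$_{\mathbf B^\dagger}$) equals $\Theta_{\mathrm M}(m)$.
   Context: Setting. $[N]=\{1,\dots,N\}$; $m,n,l,K$ are positive integers; $\gamma_1\ge 0$, $\gamma_2\ge 1$; $\boldsymbol\mu\in\mathbb R^m$; $\boldsymbol\Sigma\in\mathbb R^{m\times m}$ is symmetric positive definite with eigenvalue decomposition $\boldsymbol\Sigma=\mathbf U\boldsymbol\Lambda\mathbf U^\top$, $\mathbf U$ orthogonal, $\boldsymbol\Lambda$ diagonal with nonincreasing diagonal entries. $\mathcal X\subseteq\mathbb R^n$. $\mathbf A\in\mathbb R^{l\times m}$ and $\mathbf b\in\mathbb R^l$ are such that $\{\boldsymbol\xi\in\mathbb R^m:\mathbf A\boldsymbol\xi\le\mathbf b\}$ has at least one interior point. For $k\in[K]$, $y_k^0(\mathbf x)\in\mathbb R$ and $y_k(\mathbf x)\in\mathbb R^m$ are affine in $\mathbf x\in\mathbb R^n$. $\mathcal B_{m_1}=\{\mathbf B\in\mathbb R^{m\times m_1}:\mathbf B^\top\mathbf B=\mathbf I_{m_1}\}$. $\mathbf M\succeq0$ means $\mathbf M$ is (symmetric) positive semidefinite; $\mathbf A\bullet\mathbf B=\sum_{i,j}A_{ij}B_{ij}$. Problem (SDP): minimize $s+\gamma_2\,\mathbf I_m\bullet\mathbf Q+\sqrt{\gamma_1}\,\|\mathbf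 q\|_2$ over $\mathbf x\in\mathcal X$, $s\in\mathbb R$, $\hat{\boldsymbol\lambda}=\{\boldsymbol\lambda_1,\dots,\boldsymbol\lambda_K\}$ with $\boldsymbol\lambda_k\in\mathbb R^l_+$, $\mathbf q\in\mathbb R^m$, $\mathbf Q\in\mathbb R^{m\times m}$, subject to, for all $k\in[K]$, $$\begin{bmatrix} s-y_k^0(\mathbf x)-\boldsymbol\lambda_k^\top\mathbf b-y_k(\mathbf x)^\top\boldsymbol\mu+\boldsymbol\lambda_k^\top\mathbf A\boldsymbol\mu & \frac12\left(\mathbf q+(\mathbf U\boldsymbol\Lambda^{1/2})^\top(\mathbf A^\top\boldsymbol\lambda_k-y_k(\mathbf x))\right)^\top\\ \frac12\left(\mathbf q+(\mathbf U\boldsymbol\Lambda^{1/2})^\top(\mathbf A^\top\boldsymbol\lambda_k-y_k(\mathbf x))\right)&\mathbf Q\end{bmatrix}\succeq0 .$$ For $\mathbf B\in\mathcal B_{m_1}$, problem (R$_{\mathbf B}$): minimize $s+\gamma_2\,\mathbf I_{m_1}\bullet\mathbf Q_{\mathrm r}+\sqrt{\gamma_1}\,\|\mathbf q_{\mathrm r}\|_2$ over $\mathbf x\in\mathcal X$, $s\in\mathbb R$, $\hat{\boldsymbol\lambda}=\{\boldsymbol\lambda_1,\dots,\boldsymbol\lambda_K\}$ with $\boldsymbol\lambda_k\in\mathbb R^l_+$, $\mathbf q_{\mathrm r}\in\mathbb R^{m_1}$, $\mathbf Q_{\mathrm r}\in\mathbb R^{m_1\times m_1}$, subject to, for all $k\in[K]$,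 $$\begin{bmatrix} s-y_k^0(\mathbf x)-\boldsymbol\lambda_k^\top\mathbf b-y_k(\mathbf x)^\top\boldsymbol\mu+\boldsymbol\lambda_k^\top\mathbf A\boldsymbol\mu & \frac12\left(\mathbf q_{\mathrm r}+(\mathbf U\boldsymbol\Lambda^{1/2}\mathbf B)^\top(\mathbf A^\top\boldsymbol\lambda_k-y_k(\mathbf x))\right)^\top\\ \frac12\left(\mathbf q_{\mathrm r}+(\mathbf U\boldsymbol\Lambda^{1/2}\mathbf B)^\top(\mathbf A^\top\boldsymbol\lambda_k-y_k(\mathbf x))\right)&\mathbf Q_{\mathrm r}\end{bmatrix}\succeq0 .$$ *)

(* Defs.v *)
From HB Require Import structures.
From mathcomp Require Import all_boot all_order all_algebra.
From mathcomp Require Import all_classical all_reals.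
From mathcomp Require Import ereal topology normedtype.

Set Implicit Arguments.
Unset Strict Implicit.
Unset Printing Implicit Defensive.

Import Order.TTheory GRing.Theory Num.Theory.
Import numFieldNormedType.Exports.

Local Open Scope classical_set_scope.
Local Open Scope ring_scope.

Definition sym_psd (R : realType) (p : nat) (M : 'M[R]_p) : Prop :=
  M^T = M /\ forall v : 'cV[R]_p, 0 <= (v^T *m M *m v) 0 0.

Definition sym_pd (R : realType) (p : nat) (M : 'M[R]_p) : Prop :=
  M^T = M /\ forall v : 'cV[R]_p, v != 0 -> 0 < (v^T *m M *m v) 0 0.

Definition frob_dot (R : realType) (p q : nat) (M N : 'M[R]_(p, q)) : R :=
  \sum_i \sum_j M i j * N i j.

(* The library norm on matrices is the sup norm. *)
Definition norm2 (R : realType) (p : nat) (v : 'cV[R]_p) : R :=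
  Num.sqrt (\sum_i v i 0 ^+ 2).

Definition orthonormal_cols (R : realType) (p q : nat) : set 'M[R]_(p, q) :=
  [set B | B^T *m B = 1%:M].

Definition affine_map (R : realType) (V W : lmodType R) (f : V -> W) : Prop :=
  exists (g : {linear V -> W}) (c : W), forall x, f x = g x + c.

Definition polyhedron (R : realType) (l m : nat) (A : 'M[R]_(l, m))
    (b : 'cV[R]_l) : set 'cV[R]_m :=
  [set xi | forall i, (A *m xi) i 0 <= b i 0].

Record dro_data (R : realType) (m n l K : nat) := DroData {
  gamma1 : R;
  gamma2 : R;
  mu : 'cV[R]_m;
  Sigma : 'M[R]_m;
  U : 'M[R]_m;
  Lambda : 'rV[R]_m; (* the diagonal of the eigenvalue matrix *)
  X : set 'cV[R]_n;
  A : 'M[R]_(l, m);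
  b : 'cV[R]_l;
  y0 : 'I_K -> 'cV[R]_n -> R;
  y : 'I_K -> 'cV[R]_n -> 'cV[R]_m
}.

Record dro_assumptions (R : realType) (m n l K : nat)
    (D : dro_data R m n l K) : Prop := DroAssumptions {
  m_gt0 : (0 < m)%N;
  n_gt0 : (0 < n)%N;
  l_gt0 : (0 < l)%N;
  K_gt0 : (0 < K)%N;
  gamma1_ge0 : 0 <= gamma1 D;
  gamma2_ge1 : 1 <= gamma2 D;
  Sigma_pd : sym_pd (Sigma D);
  U_orthogonal : (U D)^T *m U D = 1%:M;
  Lambda_nonincreasing :
    forall i j : 'I_m, (i <= j)%N -> Lambda D 0 j <= Lambda D 0 i;
  Sigma_eigendecomposition :
    Sigma D = U D *m diag_mx (Lambda D) *m (U D)^T;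
  support_interior : interior (polyhedron (A D) (b D)) !=set0;
  y0_affine : forall k, affine_map (y0 D k : 'cV[R]_n -> R^o);
  y_affine : forall k, affine_map (y D k)
}.

(* Decision variables (x, s, lambda, q, Q) with q and Q of size p: p = m for
   the full problem, p = m1 for the reduced one. *)
Record dro_point (R : realType) (n l K p : nat) := DroPoint {
  px : 'cV[R]_n;
  ps : R;
  plambda : 'I_K -> 'cV[R]_l;
  pq : 'cV[R]_p;
  pQ : 'M[R]_p
}.

Section Problems.
Context (R : realType) (m n l K : nat) (D : dro_data R m n l K).

Definition ULambda_half : 'M[R]_m :=
  U D *m diag_mx (map_mx Num.sqrt (Lambda D)).

Definition dual_residual (x : 'cV[R]_n) (lambda : 'I_K -> 'cV[R]_l) (k : 'I_K) :
    'cV[R]_m :=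
  (A D)^T *m lambda k - y D k x.

(* The products below are 1 x 1 matrices. *)
Definition lmi_corner (x : 'cV[R]_n) (s : R) (lambda : 'I_K -> 'cV[R]_l)
    (k : 'I_K) : 'M[R]_1 :=
  (s - y0 D k x)%:M - (lambda k)^T *m b D - (y D k x)^T *m mu D
    + (lambda k)^T *m A D *m mu D.

Definition objective (p : nat) (z : dro_point R n l K p) : R :=
  ps z + gamma2 D * frob_dot 1%:M (pQ z) + Num.sqrt (gamma1 D) * norm2 (pq z).

Definition sdp_lmi (z : dro_point R n l K m) (k : 'I_K) : 'M[R]_(1 + m) :=
  let w := pq z + ULambda_half^T *m dual_residual (px z) (plambda z) k in
  block_mx (lmi_corner (px z) (ps z) (plambda z) k) (2^-1 *: w)^T
           (2^-1 *: w)                              (pQ z).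

Definition sdp_feasible : set (dro_point R n l K m) :=
  [set z | [/\ X D (px z),
               forall k i, 0 <= plambda z k i 0 &
               forall k, sym_psd (sdp_lmi z k)]].

Definition sdp_value : \bar R :=
  ereal_inf [set (objective z)%:E | z in sdp_feasible].

Definition sdp_optimal (z : dro_point R n l K m) : Prop :=
  sdp_feasible z /\ forall z', sdp_feasible z' -> objective z <= objective z'.

Definition red_lmi (m1 : nat) (B : 'M[R]_(m, m1)) (z : dro_point R n l K m1)
    (k : 'I_K) : 'M[R]_(1 + m1) :=
  let w := pq z + (ULambda_half *m B)^T *m
                    dual_residual (px z) (plambda z) k in
  block_mx (lmi_corner (px z) (ps z) (plambda z) k) (2^-1 *: w)^T
           (2^-1 *: w)                              (pQ z).

Definition red_feasible (m1 : nat) (B : 'M[R]_(m, m1)) :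
    set (dro_point R n l K m1) :=
  [set z | [/\ X D (px z),
               forall k i, 0 <= plambda z k i 0 &
               forall k, sym_psd (red_lmi B z k)]].

End Problems.

(* Main.v *)
Require Import Defs.
From HB Require Import structures.
From mathcomp Require Import all_boot all_order all_algebra.
From mathcomp Require Import all_classical all_reals.
From mathcomp Require Import ereal topology normedtype.
Import Order.TTheory GRing.Theory Num.Theory.
Import numFieldNormedType.Exports.
Local Open Scope classical_set_scope.
Local Open Scope ring_scope.

Set Implicit Arguments.

(** The reduced problem only sees the full one through the columns of B.
    Congruence of the full semidefinite constraint with diag(1, B) has the
    shape of the reduced constraint, with q replaced by B^T q and Q by
    B^T Q B, and congruence preserves semidefiniteness.  Hence every feasible
    point of the full problem compresses to a feasible point of the reduced
    problem, whatever B is ([compress_feasible]).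

    Compression may change the cost in general, but not when q and Q live
    in the column space of an orthonormal B: if q = B q_r and
    Q = B Q_r B^T, then B^T B = 1 makes the compressed point (q_r, Q_r), and
    B preserves Euclidean norms and traces ([compress_lift] and
    [objective_lift]).

    It remains to choose B.  An orthonormal family with fewer than m vectors
    leaves a nonzero vector orthogonal to it, so V extends to an orthonormal
    family [V, C] of any length up to m ([orthonormal_completion]).  Padding
    delta and Y11 with zeros then rewrites q' = V delta and Q' = V Y11 V^T as
    lifts along [V, C], and the cost of the compressed point is that of the
    optimal solution, that is, the optimal value. *)

(** * Orthonormal completion *)

Lemma dotmx_sum (R : realType) (p : nat) (v : 'cV[R]_p) :
  (v^T *m v) 0 0 = \sum_i v i 0 ^+ 2.
Proof. by rewrite mxE; apply: eq_bigr => i _; rewrite mxE expr2. Qed.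

Lemma dotmx_gt0 (R : realType) (p : nat) (v : 'cV[R]_p) :
  v != 0 -> 0 < (v^T *m v) 0 0.
Proof.
move=> v0; have sq_ge0 (i : 'I_p) : true -> 0 <= v i 0 ^+ 2.
  by rewrite sqr_ge0.
rewrite dotmx_sum lt0r sumr_ge0 // andbT.
apply: contra v0 => /eqP /(psumr_eq0P sq_ge0) vi0.
apply/eqP/matrixP => i j; rewrite ord1 mxE.
by apply/eqP; rewrite -sqrf_eq0 vi0.
Qed.

(** The left kernel of a matrix with fewer columns than rows is nonzero, by
    rank; normalizing one of its vectors gives the required unit vector. *)
Lemma unit_vector_orthogonal (R : realType) (m p : nat) (W : 'M[R]_(m, p)) :
  (p < m)%N -> exists c : 'cV[R]_m, W^T *m c = 0 /\ c^T *m c = 1%:M.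
Proof.
move=> ltpm.
have /rowV0Pn [u /sub_kermxP uW u0] : kermx W != 0.
  rewrite -mxrank_eq0 mxrank_ker subn_eq0 -ltnNge.
  exact: leq_ltn_trans (rank_leq_col W) ltpm.
set w := u^T; have Ww : W^T *m w = 0 by rewrite -trmx_mul uW trmx0.
have w0 : w != 0 by rewrite -(inj_eq (@trmx_inj _ _ _)) trmxK trmx0.
set a := (w^T *m w) 0 0; have a0 : 0 < a by exact: dotmx_gt0.
exists ((Num.sqrt a)^-1 *: w); split; first by rewrite -scalemxAr Ww scaler0.
have -> : ((Num.sqrt a)^-1 *: w)^T = (Num.sqrt a)^-1 *: w^T.
  exact: linearZ.
rewrite -scalemxAl -scalemxAr scalerA -invfM -expr2 sqr_sqrtr ?ltW //.
by rewrite (mx11_scalar (w^T *m w)) -/a scale_scalar_mx mulVf // gt_eqF.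
Qed.

Lemma row_mx_orthonormal (R : realType) (m p d : nat)
    (V : 'M[R]_(m, p)) (C : 'M[R]_(m, d)) :
  V^T *m V = 1%:M -> V^T *m C = 0 -> C^T *m C = 1%:M ->
  (row_mx V C)^T *m row_mx V C = 1%:M.
Proof.
move=> VV VC CC; have CV : C^T *m V = 0.
  by rewrite -[V]trmxK -trmx_mul VC trmx0.
by rewrite tr_row_mx mul_col_row VV VC CC CV -scalar_mx_block.
Qed.

Lemma orthonormal_completion (R : realType) (m p d : nat) (V : 'M[R]_(m, p)) :
  V^T *m V = 1%:M -> (p + d <= m)%N ->
  exists C : 'M[R]_(m, d), (row_mx V C)^T *m row_mx V C = 1%:M.
Proof.
move=> VV lem.
(* The induction carries the two blocks V^T C and C^T C of the Gram matrix
   separately: prepending a column to C would otherwise reassociate the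
   dimension p + (1 + d). *)
suff [C [VC CC]] : exists C : 'M[R]_(m, d), V^T *m C = 0 /\ C^T *m C = 1%:M.
  by exists C; exact: row_mx_orthonormal.
elim: d lem => [|d IHd] lem.
  by exists 0; split; [rewrite mulmx0 | apply/matrixP => -[]].
have [|C [VC CC]] := IHd; first by rewrite (leq_trans _ lem) // leq_add2l.
have [|c [Wc cc]] := @unit_vector_orthogonal R m (p + d) (row_mx V C).
  by rewrite addnS in lem.
move: Wc; rewrite tr_row_mx mul_col_mx -[0]vsubmxK => /eq_col_mx.
rewrite !linear0 => -[Vc Cc].
rewrite -[d.+1]/(1 + d)%N; exists (row_mx c C); split.
  by rewrite mul_mx_row Vc VC row_mx0.
apply: row_mx_orthonormal => //.
by rewrite -[C]trmxK -trmx_mul Cc trmx0.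
Qed.

(** * Compression of a point of the full problem *)

Lemma sym_psd_congr (R : realType) (p q : nat) (M : 'M[R]_p)
    (P : 'M[R]_(p, q)) :
  sym_psd M -> sym_psd (P^T *m M *m P).
Proof.
case=> symM psdM; split; first by rewrite !trmx_mul trmxK symM mulmxA.
by move=> v; have := psdM (P *m v); rewrite trmx_mul !mulmxA.
Qed.

Definition compress (R : realType) (m n l K p : nat) (B : 'M[R]_(m, p))
    (z : dro_point R n l K m) : dro_point R n l K p :=
  DroPoint (px z) (ps z) (plambda z) (B^T *m pq z) (B^T *m pQ z *m B).

Lemma red_lmi_compress (R : realType) (m n l K p : nat)
    (D : dro_data R m n l K) (B : 'M[R]_(m, p)) (z : dro_point R n l K m)
    (k : 'I_K) :
  red_lmi D B (compress B z) k =
  (block_mx 1%:M 0 0 B)^T *m sdp_lmi D z k *m block_mx 1%:M 0 0 B.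
Proof.
rewrite /red_lmi /sdp_lmi /=; move: (dual_residual _ _ _ _) => r.
have -> : B^T *m pq z + (ULambda_half D *m B)^T *m r =
          B^T *m (pq z + (ULambda_half D)^T *m r).
  by rewrite trmx_mul mulmxDr mulmxA.
move: (pq z + _) => w.
rewrite tr_block_mx !mulmx_block !trmx0 !trmx1.
rewrite !mul1mx !mul0mx !mulmx0 !mulmx1 !addr0 !add0r.
by rewrite scalemxAr trmx_mul trmxK.
Qed.

Lemma compress_feasible (R : realType) (m n l K p : nat)
    (D : dro_data R m n l K) (B : 'M[R]_(m, p)) (z : dro_point R n l K m) :
  sdp_feasible D z -> red_feasible D B (compress B z).
Proof.
case=> Xz lz psdz; split=> // k.
by rewrite red_lmi_compress; exact: sym_psd_congr.
Qed.

(** * Lifting along orthonormal columns *)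

Definition lift_point (R : realType) (m n l K p : nat) (B : 'M[R]_(m, p))
    (z : dro_point R n l K p) : dro_point R n l K m :=
  DroPoint (px z) (ps z) (plambda z) (B *m pq z) (B *m pQ z *m B^T).

Lemma compress_lift (R : realType) (m n l K p : nat) (B : 'M[R]_(m, p))
    (z : dro_point R n l K p) :
  B^T *m B = 1%:M -> compress B (lift_point B z) = z.
Proof.
case: z => x s lam q Q BB; rewrite /compress /lift_point /=.
by rewrite !mulmxA BB !mul1mx -mulmxA BB mulmx1.
Qed.

Lemma frob_dot1 (R : realType) (p : nat) (M : 'M[R]_p) :
  frob_dot 1%:M M = \tr M.
Proof.
apply: eq_bigr => i _; rewrite (bigD1 i) //= big1 => [|j ji].
  by rewrite mxE eqxx mul1r addr0.
by rewrite mxE eq_sym (negPf ji) mul0r.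
Qed.

Lemma norm2_isometry (R : realType) (m p : nat) (B : 'M[R]_(m, p))
    (v : 'cV[R]_p) :
  B^T *m B = 1%:M -> norm2 (B *m v) = norm2 v.
Proof.
move=> BB; rewrite /norm2 -!dotmx_sum trmx_mul mulmxA -(mulmxA v^T).
by rewrite BB mulmx1.
Qed.

Lemma objective_lift (R : realType) (m n l K p : nat)
    (D : dro_data R m n l K) (B : 'M[R]_(m, p)) (z : dro_point R n l K p) :
  B^T *m B = 1%:M -> objective D (lift_point B z) = objective D z.
Proof.
move=> BB; rewrite /objective /= !frob_dot1 norm2_isometry //.
by rewrite mxtrace_mulC mulmxA BB mul1mx.
Qed.

Lemma sdp_value_optimal (R : realType) (m n l K : nat)
    (D : dro_data R m n l K) (z : dro_point R n l K m) :
  sdp_optimal D z -> sdp_value D = (objective D z)%:E.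
Proof.
case=> fz minz; apply/eqP; rewrite eq_le; apply/andP; split.
  by apply: ereal_inf_lbound; exists z.
by apply: le_ereal_inf_tmp => _ [z' fz' <-]; rewrite lee_fin minz.
Qed.

(** * Exactness of the reduction *)

Unset Implicit Arguments.

Theorem theorem3 (R : realType) (m n l K : nat) (D : dro_data R m n l K)
  (hD : dro_assumptions D) (hKm : (K < m)%N)
  (xs : 'cV[R]_n) (ss : R) (lambdas : 'I_K -> 'cV[R]_l)
  (q' : 'cV[R]_m) (Q' : 'M[R]_m)
  (hopt : sdp_optimal D (DroPoint xs ss lambdas q' Q'))
  (V : 'M[R]_(m, K)) (Y11 : 'M[R]_K) (delta : 'cV[R]_K) (nu : 'I_K -> 'cV[R]_K)
  (hV : V^T *m V = 1%:M)
  (hY11 : sym_psd Y11)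
  (hrank : (\rank Q' <= K)%N)
  (hq' : q' = V *m delta)
  (hQ' : Q' = V *m Y11 *m V^T)
  (hnu : forall k : 'I_K,
     (ULambda_half D)^T *m ((A D)^T *m lambdas k - y D k xs) = V *m nu k)
  (m1 : nat) (hKm1 : (K <= m1)%N) (hm1m : (m1 <= m)%N) :
  exists (B : 'M[R]_(m, m1)) (C : 'M[R]_(m, m1 - K)),
    let e : (K + (m1 - K))%N = m1 := subnKC hKm1 in
    let z : dro_point R n l K m1 :=
      DroPoint xs ss lambdas
        (castmx (e, erefl 1%N) (col_mx delta 0))
        (castmx (e, e) (block_mx Y11 0 0 0)) in
    [/\ B = castmx (erefl m, e) (row_mx V C),
        (row_mx V C)^T *m row_mx V C = 1%:M,
        orthonormal_cols B,
        red_feasible D B z &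
        (objective D z)%:E = sdp_value D].
Proof.
have [|C VCon] := @orthonormal_completion R m K (m1 - K) V hV.
  by rewrite subnKC.
exists (castmx (erefl m, subnKC hKm1) (row_mx V C)), C => e z.
rewrite -/e in z *.
(* Replacing m1 by K + d with d = m1 - K turns every cast into the identity. *)
move: (m1 - K)%N C VCon e @z => d C VCon e; case: m1 / e {hKm1 hm1m} => /=.
rewrite !castmx_id; set z := DroPoint _ _ _ _ _.
have zE : DroPoint xs ss lambdas q' Q' = lift_point (row_mx V C) z.
  rewrite /lift_point /= hq' hQ' mul_row_col mulmx0 addr0.
  by rewrite mul_row_block !mulmx0 !addr0 tr_row_mx mul_row_col mul0mx addr0.
split=> //.
  rewrite -(compress_lift z VCon) -zE; apply: compress_feasible.
  by case: hopt.
by rewrite (sdp_value_optimal hopt) zE objective_lift.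
Qed.
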